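(* The class ${\rm KL}([0,1]^\infty)$ of Kolmogorov-Lipschitz continuous functions is dense in $C([0,1]^\infty)$ with respect to the maximum norm.
   Context: Kolmogorov superposition theorem (KST), Lorentz version: for each $d\ge2$ there exist irrational numbers $0<\lambda_i\le 1$, $i=1,\dots,d$, and strictly increasing Lip($\alpha$) functions $\phi_q:[0,1]\to[0,1]$, $q=0,\dots,2d$ (with $\alpha=\log_{10}2$), independent of $f$, such that every $f\in C([0,1]^d)$ can be written as $f(x_1,\dots,x_d)=\sum_{q=0}^{2d} g\left(\sum_{i=1}^d\lambda_i\phi_q(x_i)\right)$ with a continuous function $g=g_f$ on $[0,d]$. For each $d$ the $\lambda_i,\phi_q$ are fixed; $g_f$ is called the outer function of $f$. A function $f\in C([0,1]^d)$ is Kolmogorov-Lipschitz (KL) continuous if its outer function (the function $g$ in the representation) is Lipschitz continuous on $[0,d]$; its Lipschitz constant is the KL constant of $f$. A function in $C([0,1]^d)$ is regarded as a function in $C([0,1]^{d+1})$ (constant in the additional variable), hence as a continuous function of infinitely many variables. $C([0,1]^\infty)$ is the Banach space obtained as the closure of $\bigcup_{d=2}^\infty C([0,1]^d)$ in the maximum ($L^\infty$) norm. A function $f\in C([0,1]^\infty)$ is KL continuous with KL constant $C$ if there is a sequence of KL continuous functions $f_n\in C([0,1]^{d_n})$ with KL constants $\le C$ such that $f_n\to f$ in the maximum norm. ${\rm KL}([0,1]^\infty)$ is the class of all $f\in C([0,1]^\infty)$ that are KL continuous with some KL constant $C<\infty$. *)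

(* Defs.v *)
From HB Require Import structures.
From mathcomp Require Import all_boot all_order all_algebra.
From mathcomp Require Import all_classical all_reals all_analysis.

Set Implicit Arguments.
Unset Strict Implicit.
Unset Printing Implicit Defensive.

Import Order.TTheory GRing.Theory Num.Theory.
Import numFieldNormedType.Exports.

Local Open Scope classical_set_scope.
Local Open Scope ring_scope.

Definition cube (R : realType) (d : nat) : set 'rV[R]_d :=
  [set x | forall i, 0 <= x ord0 i <= 1].
Arguments cube : clear implicits.

Definition icube (R : realType) : set (nat -> R) :=
  [set x | forall i, 0 <= x i <= 1].
Arguments icube : clear implicits.

(* C([0,1]^d): functions are total on 'rV[R]_d, and their values outside the
   cube are irrelevant. *)
Definition Ccube (R : realType) (d : nat) : set ('rV[R]_d -> R) :=
  [set f | {within cube R d, continuous f}].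
Arguments Ccube : clear implicits.

(* f viewed as a function of infinitely many variables, depending on the first
   d of them only. *)
Definition cylinder (R : realType) (d : nat) (f : 'rV[R]_d -> R) :
  {uniform` icube R -> R} := fun x => f (\row_(i < d) x i).

(* C([0,1]^oo).  The topology of {uniform` A -> R} is that of the maximum norm
   over A; it does not see values outside A, so membership depends only on the
   restriction of a function to the infinite cube. *)
Definition Cicube (R : realType) : set {uniform` icube R -> R} :=
  closure (\bigcup_(d in [set d | (2 <= d)%N]) (@cylinder R d @` Ccube R d)).
Arguments Cicube : clear implicits.

Definition Lip_unit (R : realType) (alpha : R) (f : R -> R) : Prop :=
  exists M : R, forall x y : R, 0 <= x <= 1 -> 0 <= y <= 1 ->
    `|f x - f y| <= M * `|x - y| `^ alpha.

(* g is an outer function of f, for the inner data lam and phi. *)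
Definition outer_function (R : realType) (d : nat) (lam : 'I_d -> R)
    (phi : 'I_(2 * d).+1 -> R -> R) (f : 'rV[R]_d -> R) (g : R -> R) : Prop :=
  {within `[0, d%:R], continuous g} /\
  forall x : 'rV[R]_d, cube R d x ->
    f x = \sum_(q < (2 * d).+1) g (\sum_(i < d) lam i * phi q (x ord0 i)).

(* The inner data supplied by the Kolmogorov superposition theorem in Lorentz's
   version; ln 2 / ln 10 is log_10 2. *)
Record Lorentz_inner (R : realType) (d : nat) (lam : 'I_d -> R)
    (phi : 'I_(2 * d).+1 -> R -> R) : Prop := {
  lam_irrational : forall i, irrational (lam i) ;
  lam_bounds : forall i, 0 < lam i <= 1 ;
  phi_bounds : forall q x, 0 <= x <= 1 -> 0 <= phi q x <= 1 ;
  phi_increasing : forall q x y,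
    0 <= x <= 1 -> 0 <= y <= 1 -> x < y -> phi q x < phi q y ;
  phi_Lip : forall q, Lip_unit (ln 2 / ln 10) (phi q) ;
  superposition : forall f : 'rV[R]_d -> R, Ccube R d f ->
    exists g, outer_function lam phi f g }.

(* f is Kolmogorov-Lipschitz with KL constant at most C.  An outer function need
   not be unique, so it is enough that one of them be Lipschitz. *)
Definition KLcube (R : realType) (d : nat) (lam : 'I_d -> R)
    (phi : 'I_(2 * d).+1 -> R -> R) (C : R) (f : 'rV[R]_d -> R) : Prop :=
  Ccube R d f /\
  exists g, outer_function lam phi f g /\ C.-lipschitz_(`[0, d%:R]) g.

Section KLicube.
Context (R : realType) (lam : forall d, 'I_d -> R)
  (phi : forall d, 'I_(2 * d).+1 -> R -> R).

Definition KLicube_const (C : R) (f : {uniform` icube R -> R}) : Prop :=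
  exists (d : nat -> nat) (F : forall n, 'rV[R]_(d n) -> R),
    [/\ forall n, (2 <= d n)%N,
        forall n, KLcube (@lam (d n)) (@phi (d n)) C (F n) &
        {uniform icube R, (fun n => cylinder (F n)) @ \oo --> f}].

Definition KLicube : set {uniform` icube R -> R} :=
  [set f | Cicube R f /\ exists C : R, KLicube_const C f].

End KLicube.

(* A is a dense subset of the subspace B. *)
Definition dense_in (T : topologicalType) (A B : set T) : Prop :=
  A `<=` B /\ B `<=` closure A.

(* Main.v *)
Require Import Defs.
From mathcomp Require Import all_boot all_order all_algebra.
From mathcomp Require Import all_classical all_reals all_analysis.
Import numFieldNormedType.Exports.
From mathcomp Require Import lra.

(** The idea is to perturb the outer function only.  Take a cylinder function f
    of d variables and write f(x) = sum_q g(sum_i lam_i phi_q(x_i)) with g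
    continuous on the compact interval [0,d].  Lipschitz functions are
    uniformly dense among the continuous functions on a compact set, so there
    is a Lipschitz h within e/2/(2d+1) of g on [0,d].  Keeping the inner data
    and replacing g by h changes each of the 2d+1 terms by at most e/2/(2d+1),
    since the inner sums stay in [0,d]; the result F is thus within e/2 of f
    on the cube ([KLcube_dense]).  It is continuous because the inner functions
    are Hoelder continuous and h is Lipschitz, and it has the Lipschitz outer
    function h by construction, so it is a KL function.

    A KL function of finitely many variables lies in KL([0,1]^oo), through the
    constant approximating sequence ([cylinder_KLicube]).  Hence the closure
    of KL([0,1]^oo) contains every cylinder function, and then, being closed,
    all of C([0,1]^oo).

    The Lipschitz approximants of g are its inf-convolutions
    y |-> inf_(t in K) (g t + L |y - t|).  Each is L-Lipschitz on the whole
    space and at most g on K; that it is at least g - e on K once L is large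
    is where compactness enters ([near_pinfty_penalty_ge]). *)

Set Implicit Arguments.
Unset Strict Implicit.
Unset Printing Implicit Defensive.

Import Order.TTheory GRing.Theory Num.Theory.

Local Open Scope classical_set_scope.
Local Open Scope ring_scope.

(** * Lipschitz approximation on compact sets *)

Definition inf_convolution (R : realType) (V : normedModType R) (K : set V)
    (g : V -> R) (L : R) (y : V) : R :=
  inf [set g t + L * `|y - t| | t in K].

Lemma inf_convolution_le (R : realType) (V : normedModType R) (K : set V)
    (g : V -> R) (m L : R) (y t : V) :
  (forall s, K s -> m <= g s) -> 0 <= L -> K t ->
  inf_convolution K g L y <= g t + L * `|y - t|.
Proof.
move=> gm L0 Kt; apply: ge_inf; last by exists t.
exists m => _ [s Ks <-]; rewrite (le_trans (gm _ Ks))// lerDl.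
exact: mulr_ge0.
Qed.

Lemma inf_convolution_ge (R : realType) (V : normedModType R) (K : set V)
    (g : V -> R) (L b : R) (y : V) :
  K !=set0 -> (forall t, K t -> b <= g t + L * `|y - t|) ->
  b <= inf_convolution K g L y.
Proof.
move=> [t0 Kt0] Hb; apply: lb_le_inf.
  by exists (g t0 + L * `|y - t0|), t0.
by move=> _ [t Kt <-]; exact: Hb.
Qed.

(** An infimum of the L-Lipschitz functions y |-> g t + L |y - t|. *)
Lemma inf_convolution_lipschitz (R : realType) (V : normedModType R)
    (K : set V) (g : V -> R) (m L : R) :
  K !=set0 -> (forall s, K s -> m <= g s) -> 0 <= L ->
  forall x y, `|inf_convolution K g L x - inf_convolution K g L y|
    <= L * `|x - y|.
Proof.
move=> K0 gm L0.
have one_sided x y : inf_convolution K g L x - L * `|x - y|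
    <= inf_convolution K g L y.
  apply: inf_convolution_ge => // t Kt; rewrite lerBlDr.
  apply: le_trans (inf_convolution_le x gm L0 Kt) _.
  rewrite -addrA lerD2l -mulrDr ler_wpM2l// [leRHS]addrC.
  exact: ler_distD.
move=> x y; have := one_sided x y; have := one_sided y x.
by rewrite (distrC y x) ler_norml => ? ?; apply/andP; split; lra.
Qed.

(** For t close to y the continuity of g suffices, and for t far from y the
    penalty L |y - t| exceeds the oscillation of g.  Compactness is used in the
    form of [near_covering], with the slope L as the parameter going to
    infinity: it makes one L valid for all y. *)
Lemma near_pinfty_penalty_ge (R : realType) (V : normedModType R)
    (K : set V) (g : V -> R) (e : R) :
  compact K -> {within K, continuous g} -> 0 < e ->
  \forall L \near +oo, forall y, K y -> forall t, K t ->
    g y - e <= g t + L * `|y - t|.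
Proof.
move=> cK cg e0.
have [B gB] : exists B, forall t, K t -> `|g t| <= B.
  have /compact_bounded[B [_ hB]] : compact (g @` K).
    exact: continuous_compact.
  exists (B + 1) => t Kt; apply: (hB (B + 1)); last by exists t.
  by rewrite ltrDl.
have /subspace_continuousP cgK := cg.
have /near_covering_withinP covK := (compact_near_coveringP K).1 cK.
apply: (covK _ _ (fun L y => forall t, K t -> g y - e <= g t + L * `|y - t|)).
move=> y0 Ky0.
have /cvgrPdist_lt/(_ (e / 2)) := cgK _ Ky0.
rewrite divr_gt0// => /(_ isT).
rewrite /prop_near1 /= => /nbhs_ballP[d /= d0 dP].
have d20 : 0 < d / 2 by exact: divr_gt0.
(* If |y0 - y| < d/2 and |y - t| < d/2, then y and t both lie in the ball of
   radius d around y0, on which g varies by less than e/2 from g y0.  Otherwise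
   L |y - t| >= (4 B / d) (d / 2) = 2 B, which bounds g y - g t. *)
exists (ball y0 (d / 2), [set L | 4 * B / d <= L]) => /=.
  split; first exact: nbhsx_ballx.
  exact: nbhs_pinfty_ge (num_real _).
move=> [y L] /= [y0y dL] Ky t Kt.
move: y0y; rewrite -ball_normE /= => y0y.
have [gy gt] := (gB _ Ky, gB _ Kt).
have B0 : 0 <= B by exact: le_trans gy.
have L0 : 0 <= L by apply: le_trans dL; rewrite divr_ge0 ?mulr_ge0// ltW.
have [near|far] := ltP (`|y - t|) (d / 2).
  have h1 : `|g y0 - g y| < e / 2.
    by apply: dP => //; rewrite -ball_normE /=; lra.
  have h2 : `|g y0 - g t| < e / 2.
    apply: dP => //; rewrite -ball_normE /=.
    by apply: le_lt_trans (ler_distD y _ _) _; lra.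
  have : 0 <= L * `|y - t| by exact: mulr_ge0.
  by move: h1 h2; rewrite !ltr_norml => /andP[? ?] /andP[? ?]; lra.
have : 4 * B / d * (d / 2) <= L * `|y - t|.
  by apply: ler_pM; rewrite ?divr_ge0 ?mulr_ge0// ltW.
have -> : 4 * B / d * (d / 2) = 2 * B.
  by rewrite mulrA mulfVK ?gt_eqF//; lra.
by move: gy gt; rewrite !ler_norml => /andP[? ?] /andP[? ?]; lra.
Qed.

(** The approximant is Lipschitz on all of V and not just on K, so that its
    composition with a continuous function is continuous without any control
    of ranges. *)
Lemma lipschitz_approximation (R : realType) (V : normedModType R)
    (K : set V) (g : V -> R) (e : R) :
  K !=set0 -> compact K -> {within K, continuous g} -> 0 < e ->
  exists (L : R) (h : V -> R),
    (forall x y, `|h x - h y| <= L * `|x - y|) /\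
    (forall y, K y -> `|g y - h y| <= e).
Proof.
move=> K0 cK cg e0.
have [c _ gc] := compact_EVT_min K0 cK cg.
have gm t : K t -> g c <= g t by move=> Kt; apply: gc; rewrite inE.
have /filterI/(_ (nbhs_pinfty_ge (num_real 0)))/filter_ex[L [LP L0]] :=
  near_pinfty_penalty_ge cK cg e0.
exists L, (inf_convolution K g L); split;
  first exact: inf_convolution_lipschitz gm _.
move=> y Ky.
have := inf_convolution_le y gm L0 Ky.
have := inf_convolution_ge K0 (LP y Ky).
by rewrite subrr normr0 ler_norml => ? ?; apply/andP; split; lra.
Qed.

(** * Continuity of Kolmogorov sums *)

Lemma lipschitz_continuous (R : realType) (V W : normedModType R) (h : V -> W)
    (L : R) :
  (forall x y, `|h x - h y| <= L * `|x - y|) -> continuous h.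
Proof.
move=> hL x; apply/cvgrPdist_lt => e e0.
have L1 : 0 < `|L| + 1 by exact: ltr_wpDl.
near=> y.
apply: le_lt_trans (hL x y) _.
apply: (@le_lt_trans _ _ ((`|L| + 1) * `|x - y|)).
  by rewrite ler_wpM2r// (le_trans (ler_norm L))// lerDl.
rewrite -ltr_pdivlMl// mulrC.
near: y.
by apply: cvgr_dist_lt; [exact: cvg_id|exact: divr_gt0].
Unshelve. all: by end_near. Qed.

(** The modulus M |x - y|^alpha drops below e as soon as |x - y| is less than
    (e / M)^(1/alpha); |M| + 1 stands for M below because the sign of M is
    unknown. *)
Lemma Lip_unit_continuous (R : realType) (alpha : R) (f : R -> R) :
  0 < alpha -> Lip_unit alpha f -> {within `[0, 1], continuous f}.
Proof.
move=> a0 [M fM]; apply/subspace_continuousP => x x01.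
apply/cvgrPdist_lt => e e0.
have M1 : 0 < `|M| + 1 by exact: ltr_wpDl.
have eM : 0 < e / (`|M| + 1) by exact: divr_gt0.
rewrite !near_withinE.
near=> y => y01.
apply: le_lt_trans (fM _ _ _ _) _; [by move: x01; rewrite /= in_itv|
  by move: y01; rewrite /= in_itv|].
apply: (@le_lt_trans _ _ ((`|M| + 1) * `|x - y| `^ alpha)).
  by rewrite ler_wpM2r ?powR_ge0// (le_trans (ler_norm M))// lerDl.
rewrite -ltr_pdivlMl// mulrC.
have -> : e / (`|M| + 1) = ((e / (`|M| + 1)) `^ alpha^-1) `^ alpha.
  by rewrite -powRrM mulVf ?gt_eqF// powRr1// ltW.
apply: gt0_ltr_powR => //; rewrite ?nnegrE ?powR_ge0//.
near: y.
by apply: cvgr_dist_lt; [exact: cvg_id|exact: powR_gt0].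
Unshelve. all: by end_near. Qed.

Definition kolmogorov_sum (R : realType) (d : nat) (lam : 'I_d -> R)
    (phi : 'I_(2 * d).+1 -> R -> R) (g : R -> R) (x : 'rV[R]_d) : R :=
  \sum_(q < (2 * d).+1) g (\sum_(i < d) lam i * phi q (x ord0 i)).

Lemma kolmogorov_sum_continuous (R : realType) (d : nat) (lam : 'I_d -> R)
    (phi : 'I_(2 * d).+1 -> R -> R) (g : R -> R) :
  (forall q, {within `[0, 1], continuous (phi q)}) -> continuous g ->
  Ccube R d (kolmogorov_sum lam phi g).
Proof.
move=> cphi cg; apply/subspace_continuousP => x cx.
rewrite /kolmogorov_sum; apply: cvg_big => [|q _]; first exact: add_continuous.
apply: (@cvg_comp _ _ _ _ g _ (nbhs (\sum_(i < d) lam i * phi q (x ord0 i))));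
  last exact: cg.
apply: cvg_big => [|i _]; first exact: add_continuous.
apply: cvgMr.
have /subspace_continuousP/(_ (x ord0 i)) := cphi q.
rewrite /= in_itv /= => /(_ (cx i)); apply: cvg_comp.
move=> U /(@coord_continuous R 1 d ord0 i x) xU.
(* Membership in the image of a filter of neighbourhoods within the cube,
   unfolded so that the neighbourhood of the i-th coordinate can be used. *)
change (\forall y \near x, cube R d y -> U (y ord0 i)).
apply: (@filterS _ (nbhs x) _ _ _ _ xU) => y /= yU cy.
by apply: yU; rewrite in_itv; exact: cy.
Qed.

(** * Density *)

(** This is what confines the approximation of the outer function to the
    compact interval [0,d]. *)
Lemma inner_sum_bounds (R : realType) (d : nat) (lam : 'I_d -> R)
    (phi : 'I_(2 * d).+1 -> R -> R) (q : 'I_(2 * d).+1) (x : 'rV[R]_d) :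
  Lorentz_inner lam phi -> cube R d x ->
  0 <= \sum_(i < d) lam i * phi q (x ord0 i) <= d%:R.
Proof.
move=> kst cx.
have lam0 i : 0 <= lam i by have /andP[/ltW] := lam_bounds kst i.
have lam1 i : lam i <= 1 by have /andP[] := lam_bounds kst i.
have /(_ _) phib i := phi_bounds kst q (cx i).
rewrite sumr_ge0 => [|i _]; last by rewrite mulr_ge0//; case/andP: (phib i).
rewrite -[X in _ <= X%:R]card_ord -sumr_const ler_sum// => i _.
by have /andP[p0 p1] := phib i; rewrite mulr_ile1.
Qed.

(** Replacing the outer function of f by a Lipschitz approximation of it. *)
Lemma KLcube_dense (R : realType) (d : nat) (lam : 'I_d -> R)
    (phi : 'I_(2 * d).+1 -> R -> R) (f : 'rV[R]_d -> R) (e : R) :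
  Lorentz_inner lam phi -> Ccube R d f -> 0 < e ->
  exists (C : R) (F : 'rV[R]_d -> R), KLcube lam phi C F /\
    forall x, cube R d x -> `|f x - F x| < e.
Proof.
move=> kst cf e0.
have [g [cg fg]] := superposition kst cf.
have N0 : 0 < (2 * d).+1%:R :> R by rewrite ltr0n.
(* The sum has 2d+1 terms; the further factor 1/2 turns the weak bound on
   each term into the strict bound on the total. *)
have e'0 : 0 < e / 2 / (2 * d).+1%:R by rewrite !divr_gt0.
have K0 : [set` `[0, d%:R : R]] !=set0.
  by exists 0; rewrite /= in_itv /= lexx ler0n.
have [L [h [hL gh]]] :=
  lipschitz_approximation K0 (@segment_compact _ _ _) cg e'0.
have ch := lipschitz_continuous hL.
exists L, (kolmogorov_sum lam phi h); split.
  split.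
    apply: kolmogorov_sum_continuous => // q.
    apply: Lip_unit_continuous (phi_Lip kst q).
    by rewrite divr_gt0// ln_gt0// ltr1n.
  exists h; split; last by move=> [x y] _; exact: hL.
  by split=> //; exact: continuous_subspaceT.
move=> x cx; rewrite fg// -sumrB.
apply: le_lt_trans (ler_norm_sum _ _ _) _.
apply: (@le_lt_trans _ _ (\sum_(q < (2 * d).+1) e / 2 / (2 * d).+1%:R)).
  apply: ler_sum => q _; apply: gh.
  by rewrite /= in_itv; exact: inner_sum_bounds.
rewrite sumr_const card_ord -(mulr_natr (_ / _)) divfK ?gt_eqF//; lra.
Qed.

Lemma cylinder_KLicube (R : realType) (lam : forall d : nat, 'I_d -> R)
    (phi : forall d : nat, 'I_(2 * d).+1 -> R -> R) (d : nat) (C : R)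
    (F : 'rV[R]_d -> R) :
  (2 <= d)%N -> KLcube (@lam d) (@phi d) C F -> KLicube lam phi (cylinder F).
Proof.
move=> d2 klF; split.
  by apply: subset_closure; exists d => //; exists F => //; exact: klF.1.
exists C, (fun=> d), (fun=> F); split=> //.
exact: cvg_cst.
Qed.

Theorem theorem5 (R : realType) (lam : forall d : nat, 'I_d -> R)
    (phi : forall d : nat, 'I_(2 * d).+1 -> R -> R)
    (kst : forall d : nat, (2 <= d)%N -> Lorentz_inner (@lam d) (@phi d)) :
  dense_in (KLicube lam phi) (Cicube R).
Proof.
split=> [f []//|].
(* As closures are closed, it is enough to approximate cylinder functions. *)
have /closure_id -> : closed (closure (KLicube lam phi)).
  exact: closed_closure.
apply: closureS => _ [d /= d2 [f cf <-]].
move=> U /uniform_nbhs[E [entE EU]].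
move: entE; rewrite -entourage_ballE => -[e /= e0 eE].
have [C [F [klF fF]]] := KLcube_dense (kst d d2) cf e0.
exists (cylinder F); split; first exact: cylinder_KLicube klF.
apply: EU => y cy; apply: eE; rewrite /= -ball_normE /=.
by apply: fF => i; rewrite mxE; exact: cy.
Qed.
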